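(* As formal power series in $x$ with Laurent polynomial coefficients in $y$ (rational functions expanded in powers of $x$), $$\sum_{n\ge0}\sum_{m\in\mathbb{Z}}B^{H}_{R}(n,m)x^ny^m=\frac{y^2}{y^2-x(1+y^2)(1+y+y^2)},\qquad \sum_{n\ge0}\sum_{m\in\mathbb{Z}}B^{H}(n,m)x^ny^m=\frac{y(1+y+y^2)}{y^2-x(1+y^2)(1+y+y^2)},$$ $$\sum_{n\ge0}B^{H}_{R}(n,0)x^n=\sqrt{\frac{2-7x+2\sqrt{1-8x+12x^2}}{4-31x+40x^2+12x^3}},\qquad \sum_{n\ge0}B^{H}(n,0)x^n=\sqrt{\frac{2-4x-3x^2-2\sqrt{1-8x+12x^2}}{x(4-31x+40x^2+12x^3)}}.$$
   Context: A lattice path is a finite sequence of steps (vectors in $\mathbb{Z}^2$) starting at $(0,0)$; its vertices are the partial sums, and it terminates at the last vertex (the empty path terminates at $(0,0)$). Let $S_D=\{(1,1),(1,-1)\}$ and $S_{DW}=S_D\cup\{(0,1),(0,-1)\}$; $(0,\pm1)$ are vertical steps. A vertically constrained $S_{DW}$ path is a lattice path with steps in $S_{DW}$ with no two consecutive vertical steps. $B^{H}(n,m)$ is the number of vertically constrained $S_{DW}$ paths from $(0,0)$ to $(n,m)$, and $B^{H}_{R}(n,m)$ is the number of those whose first step (if any) lies in $S_D$. *)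

(* Defs.v *)
From HB Require Import structures.
From mathcomp Require Import all_boot all_order all_algebra finmap.
From mathcomp Require Import boolp classical_sets cardinality fsbigop.
From mathcomp Require Import zify.

Set Implicit Arguments.
Unset Strict Implicit.
Unset Printing Implicit Defensive.

Import Order.TTheory GRing.Theory Num.Theory.
Local Open Scope ring_scope.

(** * Lattice paths *)

Definition step : Type := (int * int)%type.

Definition SD : seq step := [:: (1, 1); (1, -1)].
Definition SV : seq step := [:: (0, 1); (0, -1)].
Definition SDW : seq step := SD ++ SV.

Definition vertically_constrained (p : seq step) : bool :=
  all (mem SDW) p &&
  sorted (fun s t : step => ~~ ((s \in SV) && (t \in SV))) p.

Definition starts_in_SD (p : seq step) : bool :=
  if p is s :: _ then s \in SD else true.

Definition endpoint (p : seq step) : step := \sum_(s <- p) s.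

Definition BH_paths (n : nat) (m : int) : set (seq step) :=
  [set p | vertically_constrained p /\ endpoint p = (n%:Z, m)]%classic.

Definition BHR_paths (n : nat) (m : int) : set (seq step) :=
  [set p | BH_paths n m p /\ starts_in_SD p]%classic.

(** [fset_set] is the expected finite set only on finite sets: see
    [finite_BH_paths] and [finite_BHR_paths]. *)
Definition BH (n : nat) (m : int) : nat := #|` fset_set (BH_paths n m)|%fset.
Definition BHR (n : nat) (m : int) : nat := #|` fset_set (BHR_paths n m)|%fset.

Lemma size_vertically_constrained (n : nat) (m : int) (p : seq step) :
  vertically_constrained p -> endpoint p = (n%:Z, m) ->
  (size p <= n.*2.+1)%N.
Proof.
suff H : forall p : seq step, vertically_constrained p ->
    exists k : nat, (endpoint p).1 = k%:Z /\
      (size p <= k.*2 + ~~ starts_in_SD p)%N.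
  move=> /H[k [ek sz]] e; move: ek; rewrite e /= => -[ek].
  by rewrite ek (leq_trans sz) // -addn1 leq_add2l; case: starts_in_SD.
elim=> [|s q IH]; first by move=> _; exists 0%N; rewrite /endpoint big_nil.
move=> /andP[/= /andP[sS qS] srt].
have /IH[k [ek sz]] : vertically_constrained q.
  by rewrite /vertically_constrained qS /= (path_sorted srt).
have e1 : (endpoint (s :: q)).1 = s.1 + k%:Z.
  by rewrite -ek /endpoint big_cons.
rewrite e1; case sD: (s \in SD).
  exists k.+1; split.
    by move: sD; rewrite !inE => /orP[] /eqP -> /=; rewrite intS.
  by move: sz; case: starts_in_SD; lia.
have sV : s \in SV.
  by move: sS; rewrite /= /SDW mem_cat sD.
exists k; split.
  by move: sV; rewrite !inE => /orP[] /eqP -> /=; rewrite add0r.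
have qD : starts_in_SD q.
  case: q srt qS {IH sz ek e1} => [//|t q] /= /andP[].
  rewrite sV /= => tV _ /andP[]; rewrite /SDW mem_cat => /orP[//|].
  by rewrite (negbTE tV).
by move: sz; rewrite qD addn0 addn1 ltnS.
Qed.

Lemma finite_vertically_constrained (n : nat) :
  finite_set [set p | vertically_constrained p /\ (endpoint p).1 = n%:Z]%classic.
Proof.
pose N := n.*2.+1.
apply: (@sub_finite_set _ _
  [set` [fset [seq val s | s <- val t] | t : N.-bseq (seq_sub SDW) in predT]%fset]).
  move=> p [vp ep] /=.
  have sz : (size p <= N)%N.
    apply: (@size_vertically_constrained n (endpoint p).2) => //.
    by rewrite -ep -surjective_pairing.
  have al : all (mem SDW) p by case/andP: vp.
  have [q qp] : exists q : seq (seq_sub SDW), [seq val s | s <- q] = p.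
    elim: p al {vp ep sz} => [|s p IH] /=; first by exists [::].
    by move=> /andP[sS /IH[q <-]]; exists (SeqSub sS :: q).
  have sq : (size q <= N)%N by rewrite -(size_map val) qp.
  by apply/imfsetP; exists (Bseq sq).
exact: finite_fset.
Qed.

Lemma finite_BH_paths (n : nat) (m : int) : finite_set (BH_paths n m).
Proof.
apply: sub_finite_set (finite_vertically_constrained n) => p [vp ep].
by split=> //; rewrite ep.
Qed.

Lemma finite_BHR_paths (n : nat) (m : int) : finite_set (BHR_paths n m).
Proof. by apply: sub_finite_set (finite_BH_paths n m) => p []. Qed.

Lemma finite_support_BH (n : nat) : finite_set [set m | BH n m != 0%N]%classic.
Proof.
apply: (sub_finite_set _ (finite_image (fun p => (endpoint p).2)
  (finite_vertically_constrained n))) => m.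
rewrite /= /BH cardfs_eq0 => /fset0Pn[p].
rewrite in_fset_set ?inE; last exact: finite_BH_paths.
by move=> [vp ep]; exists p; rewrite ep.
Qed.

Lemma finite_support_BHR (n : nat) :
  finite_set [set m | BHR n m != 0%N]%classic.
Proof.
apply: sub_finite_set (finite_support_BH n) => m; apply: contra_neq.
rewrite /BH /BHR => /eqP; rewrite cardfs_eq0 => /eqP BH0.
apply/eqP; rewrite cardfs_eq0 -fsubset0 -BH0.
apply/fsubsetP => p; rewrite !in_fset_set ?inE; first by case.
  exact: finite_BH_paths.
exact: finite_BHR_paths.
Qed.

Notation "x %:F" := (@FracField.tofrac _ x) : ring_scope.

(** * Laurent polynomials

    [laurent R] is the subring R[y, 1/y] of the field of fractions of R[y]. *)

Section Laurent.
Variable R : idomainType.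

Definition is_laurent : {pred {fraction {poly R}}} :=
  fun u => `[< exists (k : nat) (p : {poly R}), u * 'X%:F ^+ k = p%:F >].

Lemma is_laurentP u :
  reflect (exists (k : nat) (p : {poly R}), u * 'X%:F ^+ k = p%:F)
          (u \in is_laurent).
Proof. exact: asboolP. Qed.

Lemma is_laurent_poly (p : {poly R}) : p%:F \in is_laurent.
Proof. by apply/is_laurentP; exists 0%N, p; rewrite expr0 mulr1. Qed.

Lemma is_laurent_subring : subring_closed is_laurent.
Proof.
split.
- by rewrite -tofrac1 is_laurent_poly.
- move=> u v /is_laurentP[k [p up]] /is_laurentP[l [q vq]].
  apply/is_laurentP; exists (k + l)%N, (p * 'X^l - q * 'X^k).
  rewrite tofracB !tofracM !tofracXn -up -vq exprD mulrBl.
  by rewrite -!mulrA [_ ^+ l * _]mulrC.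
- move=> u v /is_laurentP[k [p up]] /is_laurentP[l [q vq]].
  apply/is_laurentP; exists (k + l)%N, (p * q).
  by rewrite tofracM -up -vq exprD mulrACA.
Qed.

Record laurent : Type := Laurent {
  laurent_val : {fraction {poly R}};
  laurent_valP : laurent_val \in is_laurent }.

HB.instance Definition _ := [isSub for laurent_val].
HB.instance Definition _ := [Choice of laurent by <:].
HB.instance Definition _ :=
  GRing.SubChoice_isSubComNzRing.Build _ _ laurent is_laurent_subring.

Definition laurent_unit : {pred laurent} :=
  fun u => `[< exists v, v * u = 1 >].

Definition laurent_inv (u : laurent) : laurent :=
  xget u [set v | v * u = 1]%classic.

Fact laurent_mulVx : {in laurent_unit, left_inverse 1 laurent_inv *%R}.
Proof. by move=> u /asboolP ex_v; exact: (xgetPex u ex_v). Qed.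

Fact laurent_unitPl (u v : laurent) : v * u = 1 -> laurent_unit u.
Proof. by move=> vu; apply/asboolP; exists v. Qed.

Fact laurent_invr_out : {in [predC laurent_unit], laurent_inv =1 id}.
Proof.
move=> u /asboolPn nu; rewrite /laurent_inv.
by case: xgetP => // v _ vu; case: nu; exists v.
Qed.

HB.instance Definition _ := GRing.ComNzRing_hasMulInverse.Build laurent
  laurent_mulVx laurent_unitPl laurent_invr_out.

Definition laurent_y : laurent := Laurent (is_laurent_poly 'X).

Lemma laurent_y_unit : laurent_y \is a GRing.unit.
Proof.
have X0 : 'X%:F != 0 :> {fraction {poly R}} by rewrite tofrac_eq0 polyX_eq0.
have yV : ('X%:F)^-1 \in is_laurent.
  by apply/is_laurentP; exists 1%N, 1; rewrite expr1 mulVf // tofrac1.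
apply: (@laurent_unitPl _ (Laurent yV)).
by apply: val_inj; rewrite /= mulVf.
Qed.

End Laurent.

(** * Formal power series in one variable *)

Record fps (R : Type) : Type := Fps { fps_coef :> nat -> R }.

Lemma fpsP (R : Type) (f g : fps R) : f =1 g <-> f = g.
Proof.
split=> [|-> //]; case: f g => [f] [g] /= fg.
by congr Fps; apply: funext.
Qed.

HB.instance Definition _ (R : Type) := gen_eqMixin (fps R).
HB.instance Definition _ (R : Type) := gen_choiceMixin (fps R).

Section FpsRing.
Variable R : comNzRingType.
Implicit Types f g h : fps R.

Definition fps_zero : fps R := Fps (fun=> 0).
Definition fps_opp f : fps R := Fps (fun n => - f n).
Definition fps_add f g : fps R := Fps (fun n => f n + g n).

Fact fps_addA : associative fps_add.
Proof. by move=> f g h; apply/fpsP => n /=; rewrite addrA. Qed.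
Fact fps_addC : commutative fps_add.
Proof. by move=> f g; apply/fpsP => n /=; rewrite addrC. Qed.
Fact fps_add0 : left_id fps_zero fps_add.
Proof. by move=> f; apply/fpsP => n /=; rewrite add0r. Qed.
Fact fps_addN : left_inverse fps_zero fps_opp fps_add.
Proof. by move=> f; apply/fpsP => n /=; rewrite addNr. Qed.

HB.instance Definition _ :=
  GRing.isZmodule.Build (fps R) fps_addA fps_addC fps_add0 fps_addN.

Definition fpsC (c : R) : fps R := Fps (fun n => if n == 0%N then c else 0).
Definition fpsX : fps R := Fps (fun n => if n == 1%N then 1 else 0).

Definition fps_mul f g : fps R :=
  Fps (fun n => \sum_(i < n.+1) f i * g (n - i)%N).

Let trunc n f : {poly R} := \poly_(i < n.+1) f i.

Let fps_mul_trunc n f g k : (k <= n)%N ->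
  fps_mul f g k = (trunc n f * trunc n g)`_k.
Proof.
move=> kn; rewrite coefM; apply: eq_bigr => i _.
by rewrite !coef_poly !ifT //; move: (ltn_ord i); lia.
Qed.

Let coef_trunc n f k : (k <= n)%N -> (trunc n f)`_k = f k.
Proof. by move=> kn; rewrite coef_poly ltnS kn. Qed.

Fact fps_mulA : associative fps_mul.
Proof.
move=> f g h; apply/fpsP => n; rewrite !(@fps_mul_trunc n) //.
transitivity (trunc n f * (trunc n g * trunc n h))`_n.
  rewrite !coefM; apply: eq_bigr => i _; congr (_ * _).
  by rewrite coef_trunc ?leq_subr // (@fps_mul_trunc n) // leq_subr.
rewrite mulrA !coefM; apply: eq_bigr => i _; congr (_ * _).
have le_in : (i <= n)%N by rewrite -ltnS.
by rewrite coef_trunc // (@fps_mul_trunc n).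
Qed.

Fact fps_mulC : commutative fps_mul.
Proof.
by move=> f g; apply/fpsP => n; rewrite !(@fps_mul_trunc n) // mulrC.
Qed.

Fact fps_mul1 : left_id (fpsC 1) fps_mul.
Proof.
move=> f; apply/fpsP => n /=; rewrite big_ord_recl /= mul1r subn0.
by rewrite big1 ?addr0 // => i _; rewrite mul0r.
Qed.

Fact fps_mulDl : left_distributive fps_mul fps_add.
Proof.
move=> f g h; apply/fpsP => n /=; rewrite -big_split.
by apply: eq_bigr => i _ /=; rewrite mulrDl.
Qed.

Fact fps_one_neq0 : fpsC 1 != fps_zero.
Proof.
by apply/eqP => /fpsP/(_ 0%N)/= /eqP; rewrite oner_eq0.
Qed.

HB.instance Definition _ := GRing.Zmodule_isComNzRing.Build (fps R)
  fps_mulA fps_mulC fps_mul1 fps_mulDl fps_one_neq0.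

Definition fps_unit : {pred fps R} := fun f => `[< exists g, g * f = 1 >].

Definition fps_inv f : fps R := xget f [set g | g * f = 1]%classic.

Fact fps_mulVx : {in fps_unit, left_inverse 1 fps_inv *%R}.
Proof. by move=> f /asboolP ex_g; exact: (xgetPex f ex_g). Qed.

Fact fps_unitPl f g : g * f = 1 -> fps_unit f.
Proof. by move=> gf; apply/asboolP; exists g. Qed.

Fact fps_invr_out : {in [predC fps_unit], fps_inv =1 id}.
Proof.
move=> f /asboolPn nf; rewrite /fps_inv.
by case: xgetP => // g _ gf; case: nf; exists g.
Qed.

HB.instance Definition _ := GRing.ComNzRing_hasMulInverse.Build (fps R)
  fps_mulVx fps_unitPl fps_invr_out.

Lemma fpsD f g n : (f + g) n = f n + g n. Proof. by []. Qed.
Lemma fpsN f n : (- f) n = - f n. Proof. by []. Qed.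
Lemma fpsM f g n : (f * g) n = \sum_(i < n.+1) f i * g (n - i)%N.
Proof. by []. Qed.
Lemma fpsM0 f g : (f * g) 0%N = f 0%N * g 0%N.
Proof. by rewrite fpsM big_ord1. Qed.

End FpsRing.


Section FpsRec.
Variables (R : Type) (x0 : R) (F : nat -> (nat -> R) -> R).

Fixpoint fps_rec_seq (n : nat) : seq R :=
  if n is n'.+1 then
    let s := fps_rec_seq n' in rcons s (F n' (nth x0 s))
  else [::].

Lemma fps_rec_ex :
  (forall n u v, (forall i, (i < n)%N -> u i = v i) -> F n u = F n v) ->
  exists f : fps R, forall n, f n = F n f.
Proof.
move=> Fext; exists (Fps (fun n => nth x0 (fps_rec_seq n.+1) n)) => n.
have sz k : size (fps_rec_seq k) = k by elim: k => //= k IH; rewrite size_rcons IH.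
have nth_stable i k : (i < k)%N ->
    nth x0 (fps_rec_seq k) i = nth x0 (fps_rec_seq i.+1) i.
  elim: k => // k IH; rewrite ltnS leq_eqVlt => /orP[/eqP -> //|ik].
  by rewrite [LHS]/= nth_rcons sz ik IH.
rewrite [LHS]/= nth_rcons sz ltnn eqxx; apply: Fext => i /nth_stable.
by [].
Qed.

End FpsRec.

Lemma fps_unitE (R : comUnitRingType) (f : fps R) :
  (f \is a GRing.unit) = (f 0%N \is a GRing.unit).
Proof.
apply/idP/idP => [fU|f0U].
  have := mulVr fU => /fpsP/(_ 0%N); rewrite fpsM0 => gf.
  by apply/unitrPr; exists (f^-1 0%N); rewrite mulrC.
pose F n (u : nat -> R) := (f 0%N)^-1 *
  ((n == 0%N)%:R - \sum_(i < n) f (n - i)%N * u i).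
have [n u v uv|g gE] := @fps_rec_ex R 0 F.
  by congr (_ * (_ - _)); apply: eq_bigr => i _; rewrite uv.
apply/unitrPr; exists g; rewrite mulrC; apply/fpsP => n.
rewrite fpsM big_ord_recr /= subnn [g n]gE mulrAC mulVr // mul1r.
under eq_bigr do rewrite mulrC.
by rewrite addrC subrK; case: eqP.
Qed.

Section FpsIdomain.
Variable R : idomainType.

Fact fps_integral : GRing.integral_domain_axiom (fps R).
Proof.
move=> f g fg0; apply/norP => -[f0 g0].
have ord (h : fps R) : h != 0 ->
    exists k, h k != 0 /\ forall i, (i < k)%N -> h i = 0.
  move=> h0; have ex : exists k, h k != 0.
    apply: contrapT => nex; case/eqP: h0; apply/fpsP => k /=.
    by apply: contrapT => /eqP hk; apply: nex; exists k.
  case: (ex_minnP ex) => k hk kmin; exists k; split=> // i ik.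
  by apply/eqP; apply: contraTT ik => /kmin; rewrite -leqNgt.
have [a [fa amin]] := ord _ f0; have [b [gb bmin]] := ord _ g0.
have /fpsP/(_ (a + b)%N) := fg0.
have ab : (a < (a + b).+1)%N by rewrite ltnS leq_addr.
rewrite fpsM (bigD1 (Ordinal ab)) //= big1 ?addr0; last first.
  move=> i; rewrite -val_eqE /= neq_ltn => /orP[ia|ai].
    by rewrite amin // mul0r.
  by rewrite bmin ?mulr0 //; move: (ltn_ord i); lia.
rewrite addKn => /eqP; rewrite mulf_eq0 => /orP[] /eqP e.
  by rewrite e eqxx in fa.
by rewrite e eqxx in gb.
Qed.

HB.instance Definition _ :=
  GRing.ComUnitRing_isIntegral.Build (fps R) fps_integral.

End FpsIdomain.

(** The square root of a fraction of power series is the power series with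
    constant term 1 whose square is that fraction. Quotients are taken in the
    field of fractions, where the denominator may be divisible by the variable. *)
Definition fps_sqrt (K : fieldType) (u : {fraction (fps K)}) : fps K :=
  xget 0 [set s : fps K | s%:F ^+ 2 = u /\ s 0%N = 1]%classic.

Lemma fps_sqrt_unique (K : fieldType) (s : fps K) :
  2 != 0 :> K -> s 0%N = 1 -> fps_sqrt (s%:F ^+ 2) = s.
Proof.
move=> K2 s0; rewrite /fps_sqrt; case: xgetP => [t _ [ts t0]|/(_ s)]; last first.
  by case; split.
move/eqP: ts; rewrite -!tofracXn tofrac_eq eqf_sqr => /orP[/eqP // |/eqP ts].
have := t0; rewrite ts fpsN s0 => /eqP; rewrite eq_sym -subr_eq0 opprK.
by rewrite -[1 + 1]/(2%:R) (negbTE K2).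
Qed.

Lemma fps_sqrtK (K : fieldType) (f : fps K) : 2 != 0 :> K -> f 0%N = 1 ->
  fps_sqrt f%:F ^+ 2 = f /\ fps_sqrt f%:F 0%N = 1.
Proof.
move=> K2 f0.
suff [s [sf s0]] : exists s : fps K, s ^+ 2 = f /\ s 0%N = 1.
  by rewrite -sf tofracXn fps_sqrt_unique.
pose F n (u : nat -> K) := if n is n'.+1 then
  2^-1 * (f n - \sum_(i < n') u i.+1 * u (n' - i)%N) else 1.
have [n u v uv|s sE] := @fps_rec_ex K 0 F.
  case: n uv => //= n uv; congr (_ * (_ - _)); apply: eq_bigr => i _.
  by rewrite !uv //; move: (ltn_ord i); lia.
have s0 : s 0%N = 1 by rewrite sE.
exists s; split=> //; apply/fpsP => -[|n]; rewrite expr2.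
  by rewrite fpsM0 s0 f0 mul1r.
rewrite fpsM big_ord_recl big_ord_recr /= s0 subn0 subnn mul1r s0 mulr1.
under eq_bigr do rewrite /bump /= add1n subSS.
rewrite addrCA -mulr2n -mulr_natl [s n.+1]sE /= mulrA divff // mul1r.
by rewrite addrC subrK.
Qed.

(* Main.v *)
From HB Require Import structures.
Require Import Defs.
From mathcomp Require Import all_boot all_order all_algebra.
From mathcomp Require Import boolp classical_sets cardinality fsbigop.
From mathcomp Require Import finmap zify ring.

(** Cutting a path at its first step gives
      BHR(n+1, m) = BH(n, m-1) + BH(n, m+1)   and
      BH(n, m) = BHR(n, m) + BHR(n, m-1) + BHR(n, m+1),
    which is the pair of bivariate generating functions.

    For the paths ending on the axis, let F_m(x) be the generating function of
    n |-> BHR(n, m) and t the operator (t F)_m = F_(m-1) + F_(m+1). The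
    recurrences say (1 - x t - x t^2) F = dirac, an equation with a unique
    solution in families of power series. The kernel splits as
    (1 - a t)(1 - b t) with a + b = x and ab = -x; the roots a = z p and
    b = z q live in Q[[z]] with x = z^2, where p + q = z and p q = -1. Each
    factor is inverted by m |-> u^|m| / sqrt(1 - 4a^2), u = a (1 + u^2), so by
    partial fractions
      F_0 = (a / sqrt(1 - 4a^2) - b / sqrt(1 - 4b^2)) / (a - b),
    and similarly for BH with a + 1 and b + 1 as numerators. Squaring, only
    symmetric functions of a and b remain apart from the cross term, where
    sqrt((1 - 4a^2)(1 - 4b^2)) = sqrt(1 - 8x + 12x^2). *)

Set Implicit Arguments.
Unset Strict Implicit.
Unset Printing Implicit Defensive.

Import GRing.Theory.
Local Open Scope ring_scope.

(** * Recurrences for the path counts *)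

Lemma SDNSV (s : step) : s \in SD -> s \notin SV.
Proof. by rewrite !inE => /orP[] /eqP ->. Qed.

(** A vertical first step is harmless exactly when the rest does not open with another one. The
    empty rest is covered because [starts_in_SD] holds of it by convention. *)
Lemma vertically_constrained_cons (s : step) (p : seq step) :
  vertically_constrained (s :: p) =
  ((s \in SD) || ((s \in SV) && starts_in_SD p)) && vertically_constrained p.
Proof.
rewrite /vertically_constrained /= /SDW mem_cat.
have [sD|_] /= := boolP (s \in SD).
  by case: p => [|t p] //=; rewrite (negbTE (SDNSV sD)).
have [sV|] //= := boolP (s \in SV).
case: p => [|t p] //=; rewrite sV /= -[_ :: _ :: SV]/(SD ++ SV) mem_cat.
have [tD|] /= := boolP (t \in SD); first by rewrite SDNSV.
by case: (t \in SV); rewrite /= ?andbF.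
Qed.

Lemma endpoint_cons (s : step) (p : seq step) :
  endpoint (s :: p) = s + endpoint p.
Proof. by rewrite /endpoint big_cons. Qed.

Lemma endpoint_cons_eq (a b n m : int) (p : seq step) :
  endpoint ((a, b) :: p) = (n, m) <-> endpoint p = (n - a, m - b).
Proof.
rewrite endpoint_cons; case: (endpoint p) => c d.
rewrite -[(a, b) + _]/(a + c, b + d).
by split=> -[*]; congr (_, _); lia.
Qed.

Lemma endpoint_fst_ge0 (p : seq step) :
  vertically_constrained p -> (0 <= (endpoint p).1)%R.
Proof.
elim: p => [|s p IH]; first by rewrite /endpoint big_nil.
rewrite vertically_constrained_cons => /andP[sS /IH].
rewrite endpoint_cons /=.
by case/orP: sS => [|/andP[+ _]]; rewrite !inE => /orP[] /eqP -> /=; lia.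
Qed.

Lemma BHR_paths0 (m : int) :
  BHR_paths 0 m = (if m == 0 then [set [::]] else set0)%classic.
Proof.
apply/seteqP; split=> p.
  case: p => [|s p] [[vp ep] sp].
    move: ep; rewrite /endpoint big_nil => -[<-]; rewrite eqxx; exact: erefl.
  (* A first step in [SD] moves right by 1 and no later step moves left, so abscissa 0 is out of
     reach. *)
  exfalso; move: vp sp; rewrite vertically_constrained_cons => /andP[_].
  move/endpoint_fst_ge0; move/(congr1 fst): ep; rewrite endpoint_cons /=.
  by move=> + + sD; move: sD; rewrite !inE => /orP[] /eqP -> /=; lia.
case: eqP => // -> /= ->; split=> //; split=> //.
by rewrite /endpoint big_nil.
Qed.

Lemma BHR_pathsS (n : nat) (m : int) :
  BHR_paths n.+1 m = (cons (1, 1) @` BH_paths n (m - 1) `|`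
                      cons (1, -1) @` BH_paths n (m + 1))%classic.
Proof.
have nE : n.+1%:Z - 1 = n by lia.
apply/seteqP; split=> p.
  case: p => [|[a b] p] [[vp ep] sp].
    by move: ep; rewrite /endpoint big_nil => -[].
  move: vp; rewrite vertically_constrained_cons => /andP[_ vp].
  move/endpoint_cons_eq: ep.
  move: sp; rewrite /= !inE => /orP[] /eqP[-> ->]; rewrite nE ?opprK => ep.
    by left; exists p.
  by right; exists p.
case=> -[q [vq eq] <-]; split=> //; split.
- by rewrite vertically_constrained_cons.
- by apply/endpoint_cons_eq; rewrite nE.
- by rewrite vertically_constrained_cons.
- by apply/endpoint_cons_eq; rewrite nE opprK.
Qed.

(** A path outside [BHR_paths] opens with a vertical step, which keeps the abscissa; what follows
    cannot open with another one, so it lies in [BHR_paths] again. *)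
Lemma BH_pathsE (n : nat) (m : int) :
  BH_paths n m = (BHR_paths n m `|` (cons (0, 1) @` BHR_paths n (m - 1) `|`
                  cons (0, -1) @` BHR_paths n (m + 1)))%classic.
Proof.
apply/seteqP; split=> p.
  case: p => [|[a b] p] [vp ep]; first by left; split.
  have := vp; rewrite vertically_constrained_cons => /andP[+ vp'].
  case/orP=> [sD|/andP[sV pD]]; first by left.
  right; move/endpoint_cons_eq: ep.
  move: sV; rewrite !inE => /orP[] /eqP[-> ->]; rewrite subr0 ?opprK => ep.
    by left; exists p.
  by right; exists p.
case=> [[]//|]; case=> -[q [[vq eq] sq] <-]; split.
- by rewrite vertically_constrained_cons sq vq.
- by apply/endpoint_cons_eq; rewrite subr0.
- by rewrite vertically_constrained_cons sq vq.
- by apply/endpoint_cons_eq; rewrite subr0 opprK.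
Qed.

Lemma card_fset_setU {T : choiceType} (A B : set T) :
  finite_set A -> finite_set B -> (A `&` B = set0)%classic ->
  #|` fset_set (A `|` B)%classic| = (#|` fset_set A| + #|` fset_set B|)%N.
Proof.
move=> fA fB AB; rewrite fset_setU // cardfsU -fset_setI // AB fset_set0.
by rewrite cardfs0 subn0.
Qed.

Lemma card_fset_set_cons {T : choiceType} (s : T) (A : set (seq T)) :
  finite_set A -> #|` fset_set (cons s @` A)%classic| = #|` fset_set A|.
Proof. by move=> fA; rewrite fset_set_image // card_imfset // => p q []. Qed.

Lemma cons_imageI {T : choiceType} (s t : T) (A B : set (seq T)) :
  s != t -> (cons s @` A `&` cons t @` B = set0)%classic.
Proof.
move=> /eqP st; apply/seteqP; split=> // _ [[p _ <-] [q _ [ts _]]].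
by case: st.
Qed.

Lemma BHR0 (m : int) : BHR 0 m = (m == 0).
Proof.
rewrite /BHR BHR_paths0; case: eqP => _; last by rewrite fset_set0 cardfs0.
by rewrite fset_set1 cardfs1.
Qed.

Lemma BHRS (n : nat) (m : int) : BHR n.+1 m = (BH n (m - 1) + BH n (m + 1))%N.
Proof.
have f k := finite_BH_paths n k.
rewrite /BHR BHR_pathsS card_fset_setU ?cons_imageI //.
- by rewrite !card_fset_set_cons.
- exact: finite_image.
- exact: finite_image.
Qed.

Lemma BHE (n : nat) (m : int) :
  BH n m = (BHR n m + (BHR n (m - 1) + BHR n (m + 1)))%N.
Proof.
have f k := finite_BHR_paths n k.
have fc s k : finite_set (cons s @` BHR_paths n k)%classic.
  exact: finite_image.
rewrite /BH BH_pathsE card_fset_setU //; first last.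
- apply/seteqP; split=> // p [[_ sp]].
  by case=> -[q _ qp]; move: sp; rewrite -qp.
- by rewrite finite_setU.
- by rewrite card_fset_setU ?cons_imageI // !card_fset_set_cons.
Qed.

(** * Laurent polynomials of finitely supported families *)

Section LaurentGeneratingFunction.
Local Notation L := (laurent int).
Local Notation y := (laurent_y int).

Definition laurent_gf (g : int -> nat) : L :=
  \sum_(m \in [set: int]%classic) (g m)%:R * y ^ m.

(** Any finite set containing the support may serve as index set, so that several families can be
    summed over a common one. *)
Lemma laurent_gfE (A : {fset int}) (g : int -> nat) :
  (forall m, g m != 0%N -> m \in A) ->
  laurent_gf g = \sum_(m <- A) (g m)%:R * y ^ m.
Proof.
move=> gA; apply: fsbigTE => m mA.
suff /eqP -> : g m == 0%N by rewrite mul0r.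
by apply: contraNT mA => /gA.
Qed.

Lemma laurent_gf_shift (k : int) (g : int -> nat) :
  finite_set [set m | g m != 0%N]%classic ->
  laurent_gf (fun m => g (m - k)) = y ^ k * laurent_gf g.
Proof.
move=> fg; rewrite {1}/laurent_gf.
rewrite (@reindex_fsbigT _ _ _ _ _ (fun m : int => m + k)); last first.
  by exists (fun m => m - k) => m; rewrite ?addrK ?subrK.
have gA m : g m != 0%N -> m \in fset_set [set m | g m != 0%N]%classic.
  by move=> gm; rewrite in_fset_set //; exact: mem_set.
rewrite (fsbigTE (fset_set [set m | g m != 0%N]%classic)) => [|m mA].
  rewrite (laurent_gfE gA) big_distrr /=; apply: eq_bigr => m _.
  by rewrite addrK mulrCA exprzDr ?laurent_y_unit // [y ^ m * _]mulrC.
rewrite addrK; suff /eqP -> : g m == 0%N by rewrite mul0r.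
by apply: contraNT mA => /gA.
Qed.

Lemma laurent_gfD (g h : int -> nat) :
  finite_set [set m | g m != 0%N]%classic ->
  finite_set [set m | h m != 0%N]%classic ->
  laurent_gf (fun m => g m + h m)%N = laurent_gf g + laurent_gf h.
Proof.
move=> fg fh.
pose A := (fset_set [set m | g m != 0%N]%classic `|`
           fset_set [set m | h m != 0%N]%classic)%fset.
have gA m : g m != 0%N -> m \in A.
  by move=> gm; rewrite in_fsetU in_fset_set // mem_set.
have hA m : h m != 0%N -> m \in A.
  by move=> hm; rewrite in_fsetU orbC in_fset_set // mem_set.
rewrite (laurent_gfE gA) (laurent_gfE hA) (@laurent_gfE A) => [|m].
  rewrite -big_split; apply: eq_bigr => m _ /=.
  by rewrite natrD mulrDl.
by rewrite addn_eq0 negb_and => /orP[/gA|/hA].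
Qed.

End LaurentGeneratingFunction.

(** * Bivariate generating functions *)

Lemma fpsC_mul (R : comNzRingType) (c : R) (f : fps R) (n : nat) :
  (fpsC c * f) n = c * f n.
Proof.
rewrite fpsM big_ord_recl /= subn0 big1 ?addr0 // => i _.
by rewrite mul0r.
Qed.

Lemma fpsX_mul0 (R : comNzRingType) (f : fps R) : (fpsX R * f) 0%N = 0.
Proof. by rewrite fpsM0 mul0r. Qed.

Lemma fpsX_mulS (R : comNzRingType) (f : fps R) (n : nat) :
  (fpsX R * f) n.+1 = f n.
Proof.
rewrite fpsM 2!big_ord_recl /= mul0r mul1r add0r subSS subn0 big1 ?addr0 //.
by move=> i _; rewrite mul0r.
Qed.

Lemma fpsC_is_zmod_morphism (R : comNzRingType) : zmod_morphism (@fpsC R).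
Proof.
move=> c d; apply/fpsP => n; rewrite fpsD fpsN /=.
by case: eqP => _ //; rewrite subr0.
Qed.

Lemma fpsC_is_monoid_morphism (R : comNzRingType) : monoid_morphism (@fpsC R).
Proof.
split=> // c d; apply/fpsP => n; rewrite fpsC_mul /=.
by case: eqP => _ //; rewrite mulr0.
Qed.

HB.instance Definition _ (R : comNzRingType) :=
  GRing.isZmodMorphism.Build R (fps R) (@fpsC R) (@fpsC_is_zmod_morphism R).
HB.instance Definition _ (R : comNzRingType) :=
  GRing.isMonoidMorphism.Build R (fps R) (@fpsC R) (@fpsC_is_monoid_morphism R).

Lemma laurent_gf_delta : laurent_gf (BHR 0) = 1.
Proof.
rewrite (@laurent_gfE [fset 0]%fset) => [|m]; last first.
  by rewrite BHR0 in_fset1 eqb0 negbK.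
by rewrite big_seq_fset1 BHR0 eqxx mul1r expr0z.
Qed.

Lemma finite_support_shift (k : int) (g : int -> nat) :
  finite_set [set m | g m != 0%N]%classic ->
  finite_set [set m | g (m - k) != 0%N]%classic.
Proof.
move=> /(finite_image (fun m => m + k)); apply: sub_finite_set => m gm.
by exists (m - k) => //; rewrite subrK.
Qed.

Lemma laurent_gf_BHRS (n : nat) :
  laurent_gf (BHR n.+1) =
  (laurent_y int + (laurent_y int)^-1) * laurent_gf (BH n).
Proof.
have f := finite_support_BH n.
(* Both terms are written as [m - k], so that the shift lemma gives the factors [y] and [y^-1]. *)
have -> : BHR n.+1 = (fun m => BH n (m - 1) + BH n (m - (-1)))%N.
  by apply/funext => m; rewrite BHRS opprK.
rewrite laurent_gfD; try exact: finite_support_shift.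
by rewrite !laurent_gf_shift // mulrDl expr1z exprN1.
Qed.

Lemma laurent_gf_BH (n : nat) :
  laurent_gf (BH n) =
  (1 + laurent_y int + (laurent_y int)^-1) * laurent_gf (BHR n).
Proof.
have f := finite_support_BHR n.
have f1 := finite_support_shift 1 f.
have fN1 := finite_support_shift (-1) f.
have -> : BH n = (fun m => BHR n m + (BHR n (m - 1) + BHR n (m - (-1))))%N.
  by apply/funext => m; rewrite BHE opprK.
rewrite laurent_gfD //; last first.
  apply: (@sub_finite_set _ _
    ([set m | BHR n (m - 1) != 0%N] `|` [set m | BHR n (m - (-1)) != 0%N])%classic).
    by move=> m /=; rewrite addn_eq0 negb_and => /orP[]; [left|right].
  by rewrite finite_setU.
rewrite laurent_gfD // !laurent_gf_shift // expr1z exprN1.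
by rewrite !mulrDl mul1r addrA.
Qed.

Section BivariateSeries.
Local Notation L := (laurent int).
Local Notation x := (fpsX L).
Local Notation y := (fpsC (laurent_y int)).
Local Notation S := (Fps (fun n => laurent_gf (BHR n))).
Local Notation T := (Fps (fun n => laurent_gf (BH n))).
Local Notation den := (y ^+ 2 - x * (1 + y ^+ 2) * (1 + y + y ^+ 2)).

Lemma fpsC_y_mulV : y * fpsC (laurent_y int)^-1 = 1.
Proof. by rewrite -rmorphM mulrV ?rmorph1 // laurent_y_unit. Qed.

(** The recurrence reads S = 1 + x (y + 1/y) T; the factor [y] clears the inverse. *)
Lemma bivariate_BHR : y * S = y + x * (1 + y ^+ 2) * T.
Proof.
have -> : S = 1 + x * fpsC (laurent_y int + (laurent_y int)^-1) * T.
  apply/fpsP => -[|n]; rewrite fpsD -mulrA ?fpsX_mul0 ?fpsX_mulS.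
    by rewrite /= laurent_gf_delta addr0.
  by rewrite fpsC_mul /= laurent_gf_BHRS add0r.
rewrite rmorphD /=; ring: fpsC_y_mulV.
Qed.

Lemma bivariate_BH : y * T = (1 + y + y ^+ 2) * S.
Proof.
have -> : T = fpsC (1 + laurent_y int + (laurent_y int)^-1) * S.
  by apply/fpsP => n; rewrite fpsC_mul /= laurent_gf_BH.
rewrite !rmorphD rmorph1 /=; ring: fpsC_y_mulV.
Qed.

(** The constant coefficient in [x] is y^2, a unit among Laurent polynomials. *)
Lemma bivariate_den_unit : den \is a GRing.unit.
Proof.
rewrite fps_unitE fpsD fpsN -!mulrA fpsX_mul0 subr0 expr2 fpsM0.
by rewrite unitrM laurent_y_unit.
Qed.

Lemma bivariate_BHRE : S = y ^+ 2 / den.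
Proof.
apply: (mulIr bivariate_den_unit); rewrite divrK ?bivariate_den_unit //.
transitivity (y * (y * S) - x * (1 + y ^+ 2) * ((1 + y + y ^+ 2) * S)).
  by ring.
by rewrite -bivariate_BH bivariate_BHR; ring.
Qed.

Lemma bivariate_BHE : T = y * (1 + y + y ^+ 2) / den.
Proof.
apply: (mulIr bivariate_den_unit); rewrite divrK ?bivariate_den_unit //.
transitivity (y * (y * T) - x * (1 + y ^+ 2) * (1 + y + y ^+ 2) * T).
  by ring.
by rewrite bivariate_BH mulrCA bivariate_BHR; ring.
Qed.

End BivariateSeries.

(** * Power series and the kernel equation *)

Section SubstSquare.
Variable R : comNzRingType.
Implicit Types f g : fps R.

(** The substitution x = z^2, sending f(x) to f(z^2). Injectivity of this morphism brings identities
    proved with the help of z back to x. *)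
Definition fps_subst_sqr f : fps R :=
  Fps (fun n => if odd n then 0 else f n./2).

Lemma fps_subst_sqr_is_zmod_morphism : zmod_morphism fps_subst_sqr.
Proof.
move=> f g; apply/fpsP => n; rewrite fpsD fpsN /=.
by case: odd; rewrite ?subr0.
Qed.

Lemma sum_even (h : nat -> R) (k : nat) :
  \sum_(i < k.*2.+1) (if odd i then 0 else h i./2) = \sum_(i < k.+1) h i.
Proof.
elim: k => [|k IH]; first by rewrite !big_ord1.
rewrite doubleS big_ord_recr big_ord_recr IH [RHS]big_ord_recr /=.
rewrite odd_double /= addr0.
by rewrite doubleK.
Qed.

Lemma fps_subst_sqr_is_monoid_morphism : monoid_morphism fps_subst_sqr.
Proof.
split=> [|f g]; apply/fpsP => n.
  by rewrite /=; case: n => [|[|n]] //=; case: odd.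
rewrite fpsM /=; case: (boolP (odd n)) => [no|ne].
  (* When [n] is odd, one of [i] and [n - i] is odd, so every product vanishes. *)
  rewrite big1 // => i _; case: ifP => [|io]; first by rewrite mul0r.
  by rewrite oddB ?no ?io ?mulr0 // -ltnS.
rewrite -[n]odd_double_half (negbTE ne) add0n; move: n./2 => k.
rewrite doubleK -(sum_even (fun i => f i * g (k - i)%N)); apply: eq_bigr => i _.
case: ifP => [|io]; first by rewrite mul0r.
have le_ik : (i <= k.*2)%N by rewrite -ltnS.
rewrite oddB // odd_double io /=; congr (_ * g _).
by have := odd_double_half i; rewrite io; lia.
Qed.

HB.instance Definition _ := GRing.isZmodMorphism.Build (fps R) (fps R)
  fps_subst_sqr fps_subst_sqr_is_zmod_morphism.
HB.instance Definition _ := GRing.isMonoidMorphism.Build (fps R) (fps R)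
  fps_subst_sqr fps_subst_sqr_is_monoid_morphism.

Lemma fps_subst_sqr_inj : injective fps_subst_sqr.
Proof.
move=> f g /fpsP fg; apply/fpsP => n.
by have := fg n.*2; rewrite /= odd_double doubleK.
Qed.

Lemma fps_subst_sqrX : fps_subst_sqr (fpsX R) = fpsX R ^+ 2.
Proof.
apply/fpsP => n; rewrite expr2; case: n => [|n]; first by rewrite fpsX_mul0.
rewrite fpsX_mulS /=; case: n => [|[|[|n]]] //=.
by case: ifP.
Qed.

End SubstSquare.

Lemma nat_fps (R : comNzRingType) (n : nat) : n%:R = fpsC n%:R :> fps R.
Proof. by rewrite rmorph_nat. Qed.

Lemma fps_half : 2 * fpsC 2^-1 = 1 :> fps rat.
Proof. by rewrite (nat_fps _ 2) -rmorphM mulfV ?rmorph1. Qed.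

Lemma fps_sqrt_ex (K : fieldType) (f : fps K) : 2 != 0 :> K -> f 0%N = 1 ->
  exists s : fps K, s ^+ 2 = f /\ s 0%N = 1.
Proof. by move=> K2 /(fps_sqrtK K2) fK; exists (fps_sqrt f%:F). Qed.

Lemma fps_sqr_inj (K : fieldType) (f g : fps K) : 2 != 0 :> K ->
  f 0%N = 1 -> g 0%N = 1 -> f ^+ 2 = g ^+ 2 -> f = g.
Proof.
move=> K2 f0 g0 fg; rewrite -(fps_sqrt_unique K2 f0) -tofracXn fg tofracXn.
exact: fps_sqrt_unique.
Qed.

(** The hypothesis is free of division, so [g] may have constant term 0, as happens for the series
    of [BH]. *)
Lemma fps_sqrt_div (K : fieldType) (f g s : fps K) : 2 != 0 :> K ->
  g != 0 -> s 0%N = 1 -> g * s ^+ 2 = f -> fps_sqrt (f%:F / g%:F) = s.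
Proof.
move=> K2 g0 s0 <-; rewrite tofracM mulrAC mulfV ?tofrac_eq0 // mul1r tofracXn.
exact: fps_sqrt_unique.
Qed.

Section Kernel.
Local Notation K := (fps rat).
Local Notation z := (fpsX rat).
Local Notation dirac m := ((m == 0)%:R : K).

(** These are the roots z/2 + v and z/2 - v of T^2 - z T - 1, where v^2 = 1 + z^2/4. *)
Lemma kernel_roots : exists p q : K, p + q = z /\ p * q = -1.
Proof.
pose h : K := fpsC 2^-1; have h2 : 2 * h = 1 := fps_half.
have [|//|v [v2 _]] := @fps_sqrt_ex _ (1 + z * (h ^+ 2 * z)) _ _ => //.
  by rewrite fpsD fpsX_mul0 addr0.
exists (z * h + v), (z * h - v); split.
- transitivity ((2 * h) * z); first by ring.
  by rewrite h2 mul1r.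
- transitivity (z * (h ^+ 2 * z) - v ^+ 2); first by ring.
  by rewrite v2; ring.
Qed.

(* The solution of [(1 - a (S + S^-1)) U = dirac], with [S] the shift, is
   [u ^ |m| / r] where [u] is the small root of [u = a (1 + u^2)]. *)
Lemma kernel_solution (a : K) : a 0%N = 0 ->
  exists (r : K) (U : int -> K),
    [/\ r ^+ 2 = 1 - 4 * a ^+ 2, r 0%N = 1, r * U 0 = 1 &
        forall m, U m = dirac m + a * (U (m - 1) + U (m + 1))].
Proof.
move=> a0; pose h : K := fpsC 2^-1; have h2 : 2 * h = 1 := fps_half.
have [|//|r [r2 r0]] := @fps_sqrt_ex _ (1 - 4 * a ^+ 2) _ _ => //.
  by rewrite fpsD fpsN expr2 2!fpsM0 a0 !mulr0 subr0.
(* [c] is the root of c^2 = c - a^2 with constant term 1. Taking u = a / c gives (1 - r) / (2 a)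
   without dividing by [a], which is not invertible. *)
pose c := h * (1 + r).
have rE : r = 2 * c - 1.
  transitivity (2 * h * (1 + r) - 1); last by rewrite /c; ring.
  by rewrite h2; ring.
have c2 : c ^+ 2 = c - a ^+ 2.
  have e : 4 * (c ^+ 2 - c + a ^+ 2) = 0.
    transitivity ((2 * c - 1) ^+ 2 - (1 - 4 * a ^+ 2)); first by ring.
    by rewrite -rE r2 subrr.
  have : c ^+ 2 - c + a ^+ 2 = h * h * (4 * (c ^+ 2 - c + a ^+ 2)).
    transitivity ((2 * h) * (2 * h) * (c ^+ 2 - c + a ^+ 2)); last by ring.
    by rewrite h2; ring.
  rewrite e mulr0 => /eqP; rewrite addr_eq0 subr_eq => /eqP ->; ring.
have cU : c \is a GRing.unit.
  by rewrite fps_unitE fpsM0 fpsD r0.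
have rU : r \is a GRing.unit by rewrite fps_unitE r0 unitr1.
pose u := a / c.
have uc : c * u = a by rewrite mulrC divrK.
have u_fix : u = a * (1 + u ^+ 2).
  apply: (mulrI cU); apply: (mulrI cU).
  transitivity (c * (c * u)); first by ring.
  transitivity (a * (c ^+ 2 + (c * u) ^+ 2)); last by ring.
  by rewrite uc c2; ring.
have ur : 1 - 2 * (a * u) = r.
  apply: (mulrI cU); transitivity (c - 2 * a * (c * u)); first by ring.
  transitivity (2 * c ^+ 2 - c); last by rewrite rE; ring.
  by rewrite uc c2; ring.
exists r, (fun m => r^-1 * u ^+ absz m); split=> //.
  by rewrite expr0 mulr1 mulrV.
move=> m; apply: (mulrI rU).
have rU_mul k : r * (r^-1 * u ^+ k) = u ^+ k by rewrite mulrA mulrV ?mul1r.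
have distr d v w : r * (d + a * (v + w)) = r * d + a * (r * v + r * w) by ring.
rewrite distr !rU_mul.
(* At 0 the equation is 1 = r + 2 a u, which is [ur]; elsewhere it is [u_fix] times a power of
   [u]. *)
case: m => [[|n]|n].
- rewrite sub0r add0r abszN absz1 eqxx mulr1 expr0 -ur expr1; ring.
- have -> : absz (n.+1%:Z - 1) = n by lia.
  have -> : absz (n.+1%:Z + 1) = n.+2 by lia.
  rewrite mulr0 add0r [absz n.+1]/= !exprS {1}u_fix; ring.
- have -> : absz (Negz n - 1) = n.+2 by lia.
  have -> : absz (Negz n + 1) = n by lia.
  have -> : absz (Negz n) = n.+1 by lia.
  rewrite mulr0 add0r !exprS {1}u_fix; ring.
Qed.

(** Combining the two relations expresses each [D m] as z^2 times a combination of values of [D];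
    hence if all coefficients below [n] vanish, so does coefficient [n]. *)
Lemma kernel_unique (D E : int -> K) :
  (forall m, D m = z ^+ 2 * (E (m - 1) + E (m + 1))) ->
  (forall m, E m = D m + (D (m - 1) + D (m + 1))) ->
  forall m, D m = 0.
Proof.
move=> DE ED.
suff D0 n m i : (i < n)%N -> D m i = 0.
  by move=> m; apply/fpsP => i; exact: (D0 i.+1).
elim: n m i => // n IH m i; rewrite ltnS => le_in.
rewrite DE expr2 -mulrA; case: i le_in => [|i] le_in; first exact: fpsX_mul0.
rewrite fpsX_mulS; case: i le_in => [|i] le_in; first exact: fpsX_mul0.
have lt_in : (i < n)%N by exact: leq_trans (leqnSn _) le_in.
by rewrite fpsX_mulS !ED !fpsD !IH ?addr0.
Qed.

(** * Partial fractions and the squares of the axis series *)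

Section Solve.
Variables (p q r1 r2 : K) (U V F H : int -> K).
Hypotheses (pDq : p + q = z) (pMq : p * q = -1).
Hypothesis UE : forall m, U m = dirac m + z * p * (U (m - 1) + U (m + 1)).
Hypothesis VE : forall m, V m = dirac m + z * q * (V (m - 1) + V (m + 1)).
Hypothesis FE : forall m, F m = dirac m + z ^+ 2 * (H (m - 1) + H (m + 1)).
Hypothesis HE : forall m, H m = F m + (F (m - 1) + F (m + 1)).

(** The partial fraction candidate for (p - q) F_m; the factor z common to a = z p and b = z q has
    been cancelled. *)
Let G m := p * U m - q * V m.

(** Since p q = -1, multiplying [UE] by -q divides it by p. *)
Let shiftU m : z * (U (m - 1) + U (m + 1)) = q * (dirac m - U m).
Proof.
transitivity (- (p * q) * (z * (U (m - 1) + U (m + 1)))).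
  by rewrite pMq; ring.
by rewrite (UE m); ring.
Qed.

Let shiftV m : z * (V (m - 1) + V (m + 1)) = p * (dirac m - V m).
Proof.
transitivity (- (p * q) * (z * (V (m - 1) + V (m + 1)))).
  by rewrite pMq; ring.
by rewrite (VE m); ring.
Qed.

Let shiftG m : z * (G (m - 1) + G (m + 1)) = U m - V m.
Proof.
transitivity (p * (z * (U (m - 1) + U (m + 1))) -
              q * (z * (V (m - 1) + V (m + 1)))); first by rewrite /G; ring.
rewrite shiftU shiftV.
by transitivity (p * q * (V m - U m)); [ring | rewrite pMq; ring].
Qed.

(** This is the system [FE], [HE] with [H] eliminated and the source scaled by p - q. Two uses of
    [shiftG] absorb the two factors z. *)
Let GE m : G m = (p - q) * dirac m + z ^+ 2 *
  ((G (m - 1) + (G (m - 1 - 1) + G (m - 1 + 1))) +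
   (G (m + 1) + (G (m + 1 - 1) + G (m + 1 + 1)))).
Proof.
apply/eqP; rewrite -subr_eq0; apply/eqP.
transitivity (G m - (p - q) * dirac m - z * (z * (G (m - 1) + G (m + 1)))
  - z * (z * (G (m - 1 - 1) + G (m - 1 + 1)) +
         z * (G (m + 1 - 1) + G (m + 1 + 1)))); first by ring.
rewrite !shiftG.
transitivity (G m - (p - q) * dirac m - z * (U m - V m) -
  (z * (U (m - 1) + U (m + 1)) - z * (V (m - 1) + V (m + 1)))); first by ring.
by rewrite shiftU shiftV -pDq /G; ring.
Qed.

(** Both sides solve the same equation with the same source, so their difference solves the
    homogeneous system and vanishes. *)
Lemma kernel_F m : (p - q) * F m = p * U m - q * V m.
Proof.
rewrite -/(G m); pose D m := (p - q) * F m - G m.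
apply/eqP; rewrite -subr_eq0; apply/eqP; rewrite -/(D m).
apply: (@kernel_unique D (fun m => D m + (D (m - 1) + D (m + 1)))) => // k.
by rewrite {1}/D FE !HE GE /D; ring.
Qed.

Lemma kernel_H m : z * (p - q) * H m = (z * p + 1) * U m - (z * q + 1) * V m.
Proof.
transitivity (z * ((p - q) * F m) +
  z * ((p - q) * F (m - 1) + (p - q) * F (m + 1))).
  by rewrite HE; ring.
by rewrite !kernel_F -/(G (m - 1)) -/(G (m + 1)) shiftG; ring.
Qed.

Hypothesis r1E : r1 ^+ 2 = 1 - 4 * (z * p) ^+ 2.
Hypothesis r2E : r2 ^+ 2 = 1 - 4 * (z * q) ^+ 2.
Hypothesis U0 : r1 * U 0 = 1.
Hypothesis V0 : r2 * V 0 = 1.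

Local Notation x := (z ^+ 2).
Local Notation den := (4 - 31 * x + 40 * x ^+ 2 + 12 * x ^+ 3).

Let sqr_sum : p ^+ 2 + q ^+ 2 = x + 2.
Proof.
transitivity ((p + q) ^+ 2 - 2 * (p * q)); first by ring.
by rewrite pDq pMq; ring.
Qed.

Lemma kernel_disc : (r1 * r2) ^+ 2 = 1 - 8 * x + 12 * x ^+ 2.
Proof.
transitivity (1 - 4 * x * (p ^+ 2 + q ^+ 2) + 16 * x ^+ 2 * (p * q) ^+ 2).
  by rewrite exprMn r1E r2E; ring.
by rewrite sqr_sum pMq; ring.
Qed.

(** The cubic factors as (x + 4)(1 - 8x + 12x^2), and (p - q)^2 = x + 4. *)
Let denE : den = ((p - q) * (r1 * r2)) ^+ 2.
Proof.
rewrite [RHS]exprMn kernel_disc.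
transitivity ((p ^+ 2 + q ^+ 2 - 2 * (p * q)) * (1 - 8 * x + 12 * x ^+ 2)).
  by rewrite sqr_sum pMq; ring.
by ring.
Qed.

(** Multiplied by r1 r2, [kernel_F] at 0 becomes p r2 - q r1. In its square only the cross term,
    with coefficient -2 p q = 2, keeps the radicals. *)
Lemma kernel_F0_sqr : den * F 0 ^+ 2 = 2 - 7 * x + 2 * (r1 * r2).
Proof.
transitivity ((r1 * r2 * ((p - q) * F 0)) ^+ 2); first by rewrite denE; ring.
rewrite kernel_F.
transitivity ((p * r2 * (r1 * U 0) - q * r1 * (r2 * V 0)) ^+ 2); first by ring.
rewrite U0 V0.
transitivity (p ^+ 2 * r2 ^+ 2 + q ^+ 2 * r1 ^+ 2 - 2 * (p * q) * (r1 * r2)).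
  by ring.
rewrite r1E r2E.
transitivity (p ^+ 2 + q ^+ 2 - 8 * x * (p * q) ^+ 2 -
  2 * (p * q) * (r1 * r2)); first by ring.
by rewrite sqr_sum pMq; ring.
Qed.

Lemma kernel_H0_sqr :
  x * den * H 0 ^+ 2 = 2 - 4 * x - 3 * x ^+ 2 - 2 * (r1 * r2).
Proof.
transitivity ((r1 * r2 * (z * (p - q) * H 0)) ^+ 2).
  by rewrite denE; ring.
rewrite kernel_H.
transitivity (((z * p + 1) * r2 * (r1 * U 0) -
               (z * q + 1) * r1 * (r2 * V 0)) ^+ 2); first by ring.
rewrite U0 V0.
(* This is the coefficient of the cross term: ab + (a + b) + 1 = -x + x + 1. *)
have e : (z * p + 1) * (z * q + 1) = 1.
  transitivity (z ^+ 2 * (p * q) + z * (p + q) + 1); first by ring.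
  by rewrite pMq pDq; ring.
transitivity ((z * p + 1) ^+ 2 * r2 ^+ 2 + (z * q + 1) ^+ 2 * r1 ^+ 2 -
  2 * ((z * p + 1) * (z * q + 1)) * (r1 * r2)); first by ring.
rewrite e r1E r2E.
transitivity (x * (p ^+ 2 + q ^+ 2) + 2 * z * (p + q) + 2 -
  4 * x * (2 * x * (p * q) ^+ 2 + 2 * z * (p * q) * (p + q)
           + (p ^+ 2 + q ^+ 2)) - 2 * (r1 * r2)); first by ring.
by rewrite sqr_sum pMq pDq; ring.
Qed.

End Solve.
End Kernel.

(** * Paths ending on the axis *)

Section UnivariateSeries.
Local Notation K := (fps rat).
Local Notation x := (fpsX rat).
Local Notation F m := (Fps (fun n => (BHR n m)%:R) : K).
Local Notation H m := (Fps (fun n => (BH n m)%:R) : K).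
Local Notation r := (fps_sqrt (1 - 8 * x + 12 * x ^+ 2)%:F : K).
Local Notation den := (4 - 31 * x + 40 * x ^+ 2 + 12 * x ^+ 3).

Lemma univariate_BHR m : F m = (m == 0)%:R + x * (H (m - 1) + H (m + 1)).
Proof.
apply/fpsP => -[|n]; rewrite fpsD ?fpsX_mul0 ?fpsX_mulS nat_fps /=.
  by rewrite BHR0 addr0.
by rewrite BHRS natrD add0r.
Qed.

Lemma univariate_BH m : H m = F m + (F (m - 1) + F (m + 1)).
Proof. by apply/fpsP => n; rewrite !fpsD /= BHE !natrD. Qed.

Lemma univariate_sqr :
  den * F 0 ^+ 2 = 2 - 7 * x + 2 * r /\
  x * den * H 0 ^+ 2 = 2 - 4 * x - 3 * x ^+ 2 - 2 * r.
Proof.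
have [|r2 r0] := @fps_sqrtK _ (1 - 8 * x + 12 * x ^+ 2) isT.
  by rewrite !fpsD fpsN expr2 [8 * x]mulrC mulrCA !fpsX_mul0.
have [p [q [pDq pMq]]] := kernel_roots.
have [r1 [U [r1E r10 U0 UE]]] := kernel_solution (fpsX_mul0 p).
have [s2 [V [s2E s20 V0 VE]]] := kernel_solution (fpsX_mul0 q).
pose phi : {rmorphism K -> K} := @fps_subst_sqr rat.
have phix : phi x = fpsX rat ^+ 2 by exact: fps_subst_sqrX.
have FE m : phi (F m) =
    (m == 0)%:R + fpsX rat ^+ 2 * (phi (H (m - 1)) + phi (H (m + 1))).
  by rewrite univariate_BHR rmorphD rmorphM rmorphD /= rmorph_nat -phix.
have HE m : phi (H m) = phi (F m) + (phi (F (m - 1)) + phi (F (m + 1))).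
  by rewrite univariate_BH !rmorphD.
(* Both series have constant term 1 and the same square; the constant term fixes the sign of the
   root. *)
have phir : phi r = r1 * s2.
  apply: fps_sqr_inj; rewrite ?fpsM0 ?r10 ?s20 ?mulr1 //.
  rewrite (kernel_disc pDq pMq r1E s2E) -rmorphXn r2.
  by rewrite !(rmorphXn, rmorphM, rmorphD, rmorphN, rmorph1, rmorph_nat) phix.
have e1 := kernel_F0_sqr pDq pMq UE VE FE HE r1E s2E U0 V0.
have e2 := kernel_H0_sqr pDq pMq UE VE FE HE r1E s2E U0 V0.
rewrite -!phix -phir in e1 e2.
(* Both identities now hold after x = z^2, and injectivity of the substitution removes it. *)
split; apply: (@fps_subst_sqr_inj rat); rewrite -[LHS]/(phi _) -[RHS]/(phi _).
  by etransitivity; [|etransitivity; [exact: e1|]]; ring.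
by etransitivity; [|etransitivity; [exact: e2|]]; ring.
Qed.

Lemma univariate_den_neq0 : den != 0.
Proof.
have -> : den = 4 + x * (-31 + 40 * x + 12 * x ^+ 2) by ring.
by apply/eqP => /fpsP/(_ 0%N); rewrite fpsD fpsX_mul0 addr0 (nat_fps _ 4).
Qed.

Lemma univariate_BHRE : F 0 = fps_sqrt ((2 - 7 * x + 2 * r)%:F / den%:F).
Proof.
symmetry; apply: fps_sqrt_div => //; first exact: univariate_den_neq0.
  by rewrite /= BHR0.
by have [] := univariate_sqr.
Qed.

Lemma univariate_BHE :
  H 0 = fps_sqrt ((2 - 4 * x - 3 * x ^+ 2 - 2 * r)%:F / (x * den)%:F).
Proof.
symmetry; apply: fps_sqrt_div => //.
(* The factor [x] is nonzero because its coefficient of index 1 is 1. *)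
- rewrite mulf_neq0 ?univariate_den_neq0 //; apply/eqP => /fpsP/(_ 1%N)/eqP.
  by rewrite oner_eq0.
- by rewrite /= BHE !BHR0.
- by have [] := univariate_sqr.
Qed.

End UnivariateSeries.

Theorem theorem15 :
  (let x : fps (laurent int) := fpsX (laurent int) in
   let y : fps (laurent int) := fpsC (laurent_y int) in
   Fps (fun n => \sum_(m \in [set: int]%classic)
                   (BHR n m)%:R * laurent_y int ^ m)
     = y ^+ 2 / (y ^+ 2 - x * (1 + y ^+ 2) * (1 + y + y ^+ 2))
   /\
   Fps (fun n => \sum_(m \in [set: int]%classic)
                   (BH n m)%:R * laurent_y int ^ m)
     = y * (1 + y + y ^+ 2) / (y ^+ 2 - x * (1 + y ^+ 2) * (1 + y + y ^+ 2)))
  /\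
  (let x : fps rat := fpsX rat in
   let r : fps rat := fps_sqrt (1 - 8 * x + 12 * x ^+ 2)%:F in
   Fps (fun n => (BHR n 0)%:R)
     = fps_sqrt ((2 - 7 * x + 2 * r)%:F /
                 (4 - 31 * x + 40 * x ^+ 2 + 12 * x ^+ 3)%:F)
   /\
   Fps (fun n => (BH n 0)%:R)
     = fps_sqrt ((2 - 4 * x - 3 * x ^+ 2 - 2 * r)%:F /
                 (x * (4 - 31 * x + 40 * x ^+ 2 + 12 * x ^+ 3))%:F)).
Proof.
split; split.
- exact: bivariate_BHRE.
- exact: bivariate_BHE.
- exact: univariate_BHRE.
- exact: univariate_BHE.
Qed.
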